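(* Consider the bounded forecasting game with parameter $C>0$, and let $\mathcal P$ be any strategy of Skeptic. Let $B^{\mathcal P}=\{\xi\in\Xi \mid \sup_n|\mathcal P_n(\xi)|<\infty\}$. Then Skeptic can force the event $$B^{\mathcal P}\ \Rightarrow\ \Big(\mathcal K^{\mathcal P}_n \text{ converges in } \mathbb R,\ \text{ or }\ \big(\limsup_n \mathcal K^{\mathcal P}_n=+\infty \text{ and } \liminf_n \mathcal K^{\mathcal P}_n=-\infty\big)\Big).$$
   Context: Bounded forecasting game (parameter $C>0$): Skeptic announces an initial capital $\mathcal K_0=D>0$. Then for $n=1,2,\ldots$: Forecaster announces $m_n\in[-C,C]$; Skeptic announces $M_n\in\mathbb R$; Reality announces $x_n\in[-C,C]$; and $\mathcal K_n:=\mathcal K_{n-1}+M_n(x_n-m_n)$. All moves are public. A path is an infinite sequence $\xi=(m_1,x_1,m_2,x_2,\ldots)$ with all $m_n,x_n\in[-C,C]$; $\Xi$ is the set of paths; an event is any subset of $\Xi$. A strategy $\mathcal P=\{\mathcal P_n\}_{n\ge1}$ of Skeptic is a sequence of real-valued functions specifying $M_n=\mathcal P_n(m_1,x_1,\ldots,m_{n-1},x_{n-1},m_n)$; we write $\mathcal P_n(\xi)$. It need not keep Skeptic's capital bounded below. Its capital process (without the initial capital) is $\mathcal K^{\mathcal P}_0=0$, $\mathcal K^{\mathcal P}_n=\mathcal K^{\mathcal P}_{n-1}+\mathcal P_n(m_1,x_1,\ldots,m_{n-1},x_{n-1},m_n)(x_n-m_n)$. Skeptic can force an event $E$ if there is a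 strategy $\mathcal Q$ of Skeptic such that $\mathcal K^{\mathcal Q}_n(\xi)\ge-1$ for all $\xi\in\Xi$ and $n\ge0$, and $\limsup_n\mathcal K^{\mathcal Q}_n(\xi)=\infty$ for every $\xi\notin E$. For events, $E_1\Rightarrow E_2$ denotes the event $E_1^c\cup E_2$. ''Converges in $\mathbb R$'' means that the limit exists and is finite. *)

(* Defs.v *)
From Stdlib Require Import Reals List.
From Coquelicot Require Import Coquelicot.
Open Scope R_scope.

(* The points of the interval [-C, C]. *)
Record move (C : R) : Type := Move {
  move_val :> R;
  move_bound : - C <= move_val <= C
}.

(* Rounds are numbered from 0: [xi n] is the pair (m_{n+1}, x_{n+1}). *)
Definition path (C : R) : Type := nat -> move C * move C.

Definition event (C : R) : Type := path C -> Prop.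

Definition event_imp {C : R} (E1 E2 : event C) : event C :=
  fun xi => ~ E1 xi \/ E2 xi.

(* A strategy maps the list [(m_1, x_1); ...; (m_{n-1}, x_{n-1})], oldest round
   first, and m_n to the bet M_n; the length of the list determines n. *)
Definition strategy (C : R) : Type := list (move C * move C) -> move C -> R.

Definition history {C : R} (xi : path C) (n : nat) : list (move C * move C) :=
  map xi (seq 0 n).

(* [bet P xi n] is P_{n+1}(xi). *)
Definition bet {C : R} (P : strategy C) (xi : path C) (n : nat) : R :=
  P (history xi n) (fst (xi n)).

Fixpoint capital {C : R} (P : strategy C) (xi : path C) (n : nat) : R :=
  match n with
  | O => 0
  | S k => capital P xi k + bet P xi k * (snd (xi k) - fst (xi k))
  end.

Definition can_force {C : R} (E : event C) : Prop :=
  exists Q : strategy C,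
    (forall (xi : path C) (n : nat), -1 <= capital Q xi n) /\
    (forall xi : path C, ~ E xi -> LimSup_seq (capital Q xi) = p_infty).

Definition bounded_bets {C : R} (P : strategy C) : event C :=
  fun xi => Rbar_lt (Sup_seq (fun n => Finite (Rabs (bet P xi n)))) p_infty.

Definition converges_or_oscillates {C : R} (P : strategy C) : event C :=
  fun xi =>
    ex_finite_lim_seq (capital P xi) \/
    (LimSup_seq (capital P xi) = p_infty /\
     LimInf_seq (capital P xi) = m_infty).

(* Main.v *)
Require Import Defs.
From Stdlib Require Import Reals List Lra Lia Classical ClassicalEpsilon.
From Coquelicot Require Import Coquelicot.
Open Scope R_scope.

(** Skeptic's capital under [P] is a martingale, and the statement is the
    martingale convergence theorem for martingales with bounded increments.

    Suppose the bets on a path are bounded and the capital does not oscillate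
    between the two infinities.  Then the capital is bounded below or bounded
    above, and replacing [P] by [-P] leaves the case in which it is bounded
    below.  Skip the bets of [P] that exceed a level [k], and stop betting for
    good once the loss exceeds [k] ([stopped_strategy]): this yields a
    strategy [S] with bets bounded by [k] and capital bounded below on all
    paths, and [S] coincides with [P] on the path at hand once [k] is large.  It remains to force the convergence of
    the capital of [S] ([forces_convergence]), which is Doob's argument.  If
    that capital is unbounded above, then [S] itself becomes infinitely rich.
    Otherwise a divergent capital crosses upwards, infinitely often, an
    interval [[alpha, beta]] of a countable grid, and betting as [S] does
    during the upcrossings only ([forces_finitely_many_upcrossings]) earns
    [beta - alpha] at each of them, while the loss stays bounded.

    There are countably many strategies to combine: one for each sign, each
    level [k] and each interval of the grid.  Their mixture with weights
    [2^-(j+1)] has capital at least -1, and it becomes infinitely rich whenever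
    one of its components does ([boundedly_forces_forall]).  The mixed bet is
    an infinite series, and in general its terms could be large; all the
    strategies above however have bounded bets, so after rescaling the series
    converges.  This is why the argument uses [boundedly_forces] in place of
    [can_force]. *)

(** * Strategies as predictable processes *)

(** It is easier to describe bets as functions of the whole path; this is the
    condition under which they can be computed from the moves already seen. *)
Definition predictable {C : R} (B : path C -> nat -> R) : Prop :=
  forall (n : nat) (xi xi' : path C),
    (forall i, (i < n)%nat -> xi i = xi' i) ->
    fst (xi n) = fst (xi' n) -> B xi n = B xi' n.

(** Any way to complete the known moves to a path will do; here the current
    forecast is repeated for ever, as forecast and as outcome. *)
Lemma predictable_strategy {C : R} (B : path C -> nat -> R) :
  predictable B ->
  exists Q : strategy C, forall xi n, bet Q xi n = B xi n.
Proof.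
  intros HB.
  exists (fun h m => B (fun i => nth i h (m, m)) (length h)).
  intros xi n. unfold bet.
  assert (Hlen : length (history xi n) = n).
  { unfold history. now rewrite length_map, length_seq. }
  rewrite Hlen. apply HB.
  - intros i Hi.
    rewrite (nth_indep _ _ (xi 0%nat)) by (rewrite Hlen; exact Hi).
    unfold history. rewrite map_nth, seq_nth by exact Hi. reflexivity.
  - rewrite nth_overflow by (rewrite Hlen; apply le_n). reflexivity.
Qed.

Lemma bet_predictable {C : R} (P : strategy C) : predictable (bet P).
Proof.
  intros n xi xi' H Hm. unfold bet, history. rewrite Hm. f_equal.
  apply map_ext_in. intros i Hi. apply in_seq in Hi. apply H. lia.
Qed.

Lemma capital_ext {C : R} (P : strategy C) (n : nat) (xi xi' : path C) :
  (forall i, (i < n)%nat -> xi i = xi' i) -> capital P xi n = capital P xi' n.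
Proof.
  induction n as [|n IH]; intros H; simpl; [reflexivity|].
  rewrite IH by (intros; apply H; lia).
  rewrite (bet_predictable P n xi xi').
  - rewrite (H n) by lia. reflexivity.
  - intros i Hi. apply H. lia.
  - rewrite (H n) by lia. reflexivity.
Qed.

Lemma move_diff_bound {C : R} (x m : move C) : Rabs (x - m) <= 2 * C.
Proof.
  destruct (move_bound _ x), (move_bound _ m). apply Rabs_le. lra.
Qed.

Lemma increment_bound {C : R} (a b : R) (x m : move C) :
  Rabs b <= a -> Rabs (b * (x - m)) <= a * (2 * C).
Proof.
  intros Hb. rewrite Rabs_mult.
  apply Rmult_le_compat; auto using Rabs_pos, move_diff_bound.
Qed.

Definition scale_strategy {C : R} (t : R) (P : strategy C) : strategy C :=
  fun h m => t * P h m.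

Lemma capital_scale {C : R} (t : R) (P : strategy C) (xi : path C) (n : nat) :
  capital (scale_strategy t P) xi n = t * capital P xi n.
Proof.
  induction n as [|n IH]; simpl; [ring|].
  rewrite IH. unfold bet, scale_strategy. ring.
Qed.

(** * Forcing with bounded bets *)

Definition unbounded_above (u : nat -> R) : Prop := forall M, exists n, M < u n.

(** Compared with [can_force], the uniform bound on the bets makes weighted
    sums of infinitely many strategies converge at every move. *)
Definition boundedly_forces {C : R} (E : event C) : Prop :=
  exists Q : strategy C,
    (forall xi n, Rabs (bet Q xi n) <= 1) /\
    (forall xi n, -1 <= capital Q xi n) /\
    (forall xi, ~ E xi -> unbounded_above (capital Q xi)).

Lemma finite_prefix_bound (u : nat -> R) (N : nat) :
  exists K, forall n, (n < N)%nat -> u n <= K.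
Proof.
  induction N as [|N [K HK]].
  - exists 0. intros n Hn. lia.
  - exists (Rmax K (u N)). intros n Hn.
    destruct (Nat.eq_dec n N) as [->|Hne]; [apply Rmax_r|].
    apply Rle_trans with K; [apply HK; lia|apply Rmax_l].
Qed.

Lemma unbounded_above_LimSup (u : nat -> R) :
  unbounded_above u -> LimSup_seq u = p_infty.
Proof.
  intros Hu. apply is_LimSup_seq_unique. intros M N.
  destruct (finite_prefix_bound u N) as [K HK].
  destruct (Hu (Rmax K M)) as [n Hn].
  pose proof (Rmax_l K M). pose proof (Rmax_r K M).
  exists n. split; [|lra].
  destruct (Nat.le_gt_cases N n) as [Hle|Hlt]; [exact Hle|].
  specialize (HK n Hlt). lra.
Qed.

Lemma boundedly_forces_can_force {C : R} (E : event C) :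
  boundedly_forces E -> can_force E.
Proof.
  intros [Q [_ [H1 H2]]]. exists Q. split; [exact H1|].
  intros xi Hxi. apply unbounded_above_LimSup. auto.
Qed.

Lemma boundedly_forces_mono {C : R} (E F : event C) :
  (forall xi, E xi -> F xi) -> boundedly_forces E -> boundedly_forces F.
Proof.
  intros HEF [Q [H0 [H1 H2]]]. exists Q. repeat split; auto.
Qed.

Lemma boundedly_forces_rescale {C : R} (E : event C) (Q : strategy C) (a L : R) :
  (forall xi n, Rabs (bet Q xi n) <= a) ->
  (forall xi n, - L <= capital Q xi n) ->
  (forall xi, ~ E xi -> unbounded_above (capital Q xi)) ->
  boundedly_forces E.
Proof.
  intros Ha HL HE.
  set (T := 1 + Rabs a + Rabs L).
  assert (HT : 0 < T).
  { unfold T. pose proof (Rabs_pos a). pose proof (Rabs_pos L). lra. }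
  assert (HaT : a <= T).
  { unfold T. pose proof (Rle_abs a). pose proof (Rabs_pos L). lra. }
  assert (HLT : L <= T).
  { unfold T. pose proof (Rle_abs L). pose proof (Rabs_pos a). lra. }
  assert (HiT : 0 < / T) by now apply Rinv_0_lt_compat.
  assert (HTT : / T * T = 1) by (field; lra).
  exists (scale_strategy (/ T) Q). repeat split.
  - intros xi n.
    change (Rabs (/ T * bet Q xi n) <= 1).
    rewrite Rabs_mult, (Rabs_pos_eq (/ T)) by lra.
    rewrite <- HTT. apply Rmult_le_compat_l; [lra|].
    specialize (Ha xi n). lra.
  - intros xi n. rewrite capital_scale.
    replace (-1) with (/ T * - T) by lra.
    apply Rmult_le_compat_l; [lra|]. specialize (HL xi n). lra.
  - intros xi Hxi M. destruct (HE xi Hxi (T * M)) as [n Hn].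
    exists n. rewrite capital_scale.
    replace M with (/ T * (T * M)) by (field; lra).
    apply Rmult_lt_compat_l; assumption.
Qed.

Lemma term_le_series (a : nat -> R) (l : R) (j : nat) :
  (forall k, 0 <= a k) -> is_series a l -> a j <= l.
Proof.
  intros Ha Hl.
  assert (Hge : forall n, a n <= sum_n a n).
  { assert (H0 : forall n, 0 <= sum_n a n).
    { induction n as [|n IH].
      - rewrite sum_O. apply Ha.
      - rewrite sum_Sn. apply Rplus_le_le_0_compat; auto. }
    intros [|n].
    - rewrite sum_O. lra.
    - rewrite sum_Sn. specialize (H0 n).
      change (a (S n) <= sum_n a n + a (S n)). lra. }
  apply (is_lim_seq_incr_compare (sum_n a)) with (n := j) in Hl.
  - specialize (Hge j). lra.
  - intros n. rewrite sum_Sn. specialize (Ha (S n)).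
    change (sum_n a n <= sum_n a n + a (S n)). lra.
Qed.

Lemma is_series_half_pow : is_series (fun k => (/ 2) ^ S k) 1.
Proof.
  replace 1 with (/ 2 * / (1 - / 2)) by field.
  apply (is_series_scal (/ 2) (fun k => (/ 2) ^ k)).
  apply is_series_geom. rewrite Rabs_pos_eq; lra.
Qed.

(** The mixture of the given strategies with weights [2^-(k+1)] works: each
    component loses at most 1, hence the gains of any one of them, times its
    weight, remain after subtracting at most 1 for all the others. *)
Lemma boundedly_forces_forall {C : R} (E : nat -> event C) :
  (forall k, boundedly_forces (E k)) ->
  boundedly_forces (fun xi => forall k, E k xi).
Proof.
  intros HE.
  set (Qs := fun k => proj1_sig (constructive_indefinite_description _ (HE k))).
  assert (HQs : forall k,
    (forall xi n, Rabs (bet (Qs k) xi n) <= 1) /\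
    (forall xi n, -1 <= capital (Qs k) xi n) /\
    (forall xi, ~ E k xi -> unbounded_above (capital (Qs k) xi))).
  { intros k. exact (proj2_sig (constructive_indefinite_description _ (HE k))). }
  clearbody Qs.
  set (w := fun k => (/ 2) ^ S k).
  assert (Hw : forall k, 0 < w k) by (intros k; apply pow_lt; lra).
  pose proof is_series_half_pow as Hw1. fold w in Hw1.
  set (Q := (fun h m => Series (fun k => w k * Qs k h m)) : strategy C).
  assert (Hbet : forall xi n,
    is_series (fun k => w k * bet (Qs k) xi n) (bet Q xi n)).
  { intros xi n. apply Series_correct.
    apply (ex_series_le (fun k => w k * bet (Qs k) xi n) w);
      [|now exists 1].
    intros k. change (Rabs (w k * bet (Qs k) xi n) <= w k).
    rewrite Rabs_mult, (Rabs_pos_eq (w k)) by (apply Rlt_le, Hw).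
    rewrite <- (Rmult_1_r (w k)) at 2.
    apply Rmult_le_compat_l; [apply Rlt_le, Hw|apply (HQs k)]. }
  assert (Hcap : forall xi n,
    is_series (fun k => w k * capital (Qs k) xi n) (capital Q xi n)).
  { intros xi n. induction n as [|n IH]; simpl.
    - apply is_series_ext with (fun k => 0 * w k); [intros; simpl; ring|].
      pose proof (is_series_scal 0 w 1 Hw1 : is_series _ (0 * 1)) as Hz.
      rewrite Rmult_1_r in Hz. exact Hz.
    - set (d := snd (xi n) - fst (xi n)).
      apply is_series_ext with
        (fun k => w k * capital (Qs k) xi n + d * (w k * bet (Qs k) xi n)).
      + intros k. simpl. ring.
      + rewrite (Rmult_comm (bet Q xi n)).
        apply (is_series_plus (fun k => w k * capital (Qs k) xi n)
                 (fun k => d * (w k * bet (Qs k) xi n))); [exact IH|].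
        apply (is_series_scal d (fun k => w k * bet (Qs k) xi n)), Hbet. }
  (* The two bounds on the bet and the bounds on the capital all follow from
     comparing a series of nonnegative terms with one of these terms. *)
  assert (Hcomp : forall (f : nat -> R) (s l : R) (j : nat),
    is_series (fun k => w k * f k) l -> (forall k, 0 <= 1 + s * f k) ->
    w j * (1 + s * f j) <= 1 + s * l).
  { intros f s l j Hl Hf.
    apply (term_le_series (fun k => w k * (1 + s * f k))).
    - intros k. apply Rmult_le_pos; [apply Rlt_le, Hw|apply Hf].
    - apply is_series_ext with (fun k => w k + s * (w k * f k));
        [intros; simpl; ring|].
      apply (is_series_plus w (fun k => s * (w k * f k))); [exact Hw1|].
      apply (is_series_scal s (fun k => w k * f k)), Hl. }
  assert (Hpos : forall (f : nat -> R) (s l : R),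
    is_series (fun k => w k * f k) l -> (forall k, 0 <= 1 + s * f k) ->
    0 <= 1 + s * l).
  { intros f s l Hl Hf. apply Rle_trans with (2 := Hcomp f s l 0%nat Hl Hf).
    apply Rmult_le_pos; [apply Rlt_le, Hw|apply Hf]. }
  assert (Hlow : forall xi n k, 0 <= 1 + 1 * capital (Qs k) xi n).
  { intros xi n k. destruct (HQs k) as [_ [H _]]. specialize (H xi n). lra. }
  exists Q. repeat split.
  - intros xi n. apply Rabs_le.
    assert (Hk : forall k, -1 <= bet (Qs k) xi n <= 1).
    { intros k. destruct (HQs k) as [H _]. specialize (H xi n).
      apply Rabs_le_between in H. lra. }
    assert (H1 : 0 <= 1 + 1 * bet Q xi n).
    { apply (Hpos _ _ _ (Hbet xi n)). intros k. specialize (Hk k). lra. }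
    assert (H2 : 0 <= 1 + -1 * bet Q xi n).
    { apply (Hpos _ _ _ (Hbet xi n)). intros k. specialize (Hk k). lra. }
    lra.
  - intros xi n.
    pose proof (Hpos _ 1 _ (Hcap xi n) (Hlow xi n)). lra.
  - intros xi Hxi M.
    apply not_all_ex_not in Hxi. destruct Hxi as [j Hj].
    destruct (HQs j) as [_ [_ HU]].
    destruct (HU xi Hj ((M + 1) / w j)) as [n Hn]. exists n.
    pose proof (Hcomp _ 1 _ j (Hcap xi n) (Hlow xi n)) as H.
    pose proof (Hw j) as Hwj.
    apply Rmult_lt_compat_l with (r := w j) in Hn; [|exact Hwj].
    replace (w j * ((M + 1) / w j)) with (M + 1) in Hn by (field; lra).
    lra.
Qed.

Lemma boundedly_forces_and {C : R} (E F : event C) :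
  boundedly_forces E -> boundedly_forces F ->
  boundedly_forces (fun xi => E xi /\ F xi).
Proof.
  intros HE HF.
  apply boundedly_forces_mono with
    (fun xi => forall k : nat, (match k with O => E | S _ => F end) xi).
  - intros xi H. split; [exact (H 0%nat)|exact (H 1%nat)].
  - apply boundedly_forces_forall. intros [|k]; assumption.
Qed.

(** * Upcrossings *)

(** One counter records both the number of completed upcrossings, which is half
    of it, and the phase: it is odd while an upcrossing of [[alpha, beta]] is
    under way.  [crossings alpha beta y n] has looked at [y i] for [i < n]. *)
Fixpoint crossings (alpha beta : R) (y : nat -> R) (n : nat) : nat :=
  match n with
  | O => O
  | S k =>
      let c := crossings alpha beta y k in
      if Nat.odd c then (if Rle_dec beta (y k) then S c else c)
      else (if Rle_dec (y k) alpha then S c else c)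
  end.

Lemma crossings_ext (alpha beta : R) (y z : nat -> R) (n : nat) :
  (forall i, (i < n)%nat -> y i = z i) ->
  crossings alpha beta y n = crossings alpha beta z n.
Proof.
  induction n as [|n IH]; intros H; simpl; [reflexivity|].
  rewrite IH by (intros; apply H; lia). rewrite (H n) by lia. reflexivity.
Qed.

Lemma crossings_unbounded (alpha beta : R) (y : nat -> R) :
  (forall N, exists n, (N <= n)%nat /\ y n <= alpha) ->
  (forall N, exists n, (N <= n)%nat /\ beta <= y n) ->
  forall k, exists n, (k <= crossings alpha beta y n)%nat.
Proof.
  intros Ha Hb k.
  assert (Hmono : forall n m, (n <= m)%nat ->
    (crossings alpha beta y n <= crossings alpha beta y m)%nat).
  { intros n m Hnm. induction Hnm as [|m _ IH]; [lia|]. simpl.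
    destruct (Nat.odd _); destruct (Rle_dec _ _); lia. }
  induction k as [|k [n Hn]]; [exists 0%nat; lia|].
  destruct (Nat.odd k) eqn:Hk.
  - destruct (Hb n) as [m [Hm Hy]]. exists (S m). simpl.
    specialize (Hmono n m Hm).
    destruct (Nat.eq_dec (crossings alpha beta y m) k) as [->|Hne].
    + rewrite Hk. destruct (Rle_dec beta (y m)); [lia|contradiction].
    + destruct (Nat.odd (crossings _ _ _ _)); destruct (Rle_dec _ _); lia.
  - destruct (Ha n) as [m [Hm Hy]]. exists (S m). simpl.
    specialize (Hmono n m Hm).
    destruct (Nat.eq_dec (crossings alpha beta y m) k) as [->|Hne].
    + rewrite Hk. destruct (Rle_dec (y m) alpha); [lia|contradiction].
    + destruct (Nat.odd (crossings _ _ _ _)); destruct (Rle_dec _ _); lia.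
Qed.

(** What the counter [c] guarantees at the level [y]: a gain of [beta - alpha]
    for each completed upcrossing, and the progress of the current one. *)
Definition crossing_value (alpha beta : R) (c : nat) (y : R) : R :=
  (beta - alpha) * INR (Nat.div2 c) + (if Nat.odd c then y - alpha else 0).

(** An upcrossing starts below [alpha] and ends above [beta], so that a change
    of the counter never increases the guaranteed value; between the changes
    the value and the gain vary together. *)
Lemma crossing_value_le_gain (alpha beta : R) (y g : nat -> R) :
  g 0%nat = 0 ->
  (forall n, g (S n) = g n +
     (if Nat.odd (crossings alpha beta y (S n)) then y (S n) - y n else 0)) ->
  forall n, crossing_value alpha beta (crossings alpha beta y n) (y n) <= g n.
Proof.
  intros H0 HS n. induction n as [|n IH].
  - rewrite H0. unfold crossing_value. simpl. lra.
  - assert (Hupd : crossing_value alpha beta (crossings alpha beta y (S n)) (y n)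
              <= crossing_value alpha beta (crossings alpha beta y n) (y n)).
    { simpl. set (c := crossings alpha beta y n).
      unfold crossing_value. destruct (Nat.odd c) eqn:Hc.
      - destruct (Rle_dec beta (y n)) as [Hy|_]; [|rewrite Hc; lra].
        rewrite Nat.odd_succ, <- Nat.negb_odd, Hc. simpl negb. cbv iota.
        replace (Nat.div2 (S c)) with (S (Nat.div2 c)).
        + rewrite S_INR. lra.
        + apply Nat.odd_spec in Hc. destruct Hc as [q ->].
          replace (S (2 * q + 1)) with (2 * (S q))%nat by lia.
          replace (2 * q + 1)%nat with (S (2 * q)) by lia.
          now rewrite Nat.div2_succ_double, Nat.div2_double.
      - destruct (Rle_dec (y n) alpha) as [Hy|_]; [|rewrite Hc; lra].
        rewrite Nat.odd_succ, <- Nat.negb_odd, Hc. simpl negb. cbv iota.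
        replace (Nat.div2 (S c)) with (Nat.div2 c).
        + lra.
        + rewrite <- Nat.negb_even in Hc. apply Bool.negb_false_iff in Hc.
          apply Nat.even_spec in Hc. destruct Hc as [q ->].
          now rewrite Nat.div2_succ_double, Nat.div2_double. }
    rewrite HS.
    assert (Hvar : crossing_value alpha beta (crossings alpha beta y (S n)) (y (S n))
      = crossing_value alpha beta (crossings alpha beta y (S n)) (y n)
        + (if Nat.odd (crossings alpha beta y (S n)) then y (S n) - y n else 0)).
    { unfold crossing_value. destruct (Nat.odd _); lra. }
    lra.
Qed.

(** Bet as [S] does during the upcrossings of its capital, and abstain
    otherwise.  An unfinished upcrossing costs at most the distance from
    [alpha] to the lower bound of the capital. *)
Lemma forces_finitely_many_upcrossings {C : R} (S : strategy C)
    (a L alpha beta : R) :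
  (forall xi n, Rabs (bet S xi n) <= a) ->
  (forall xi n, - L <= capital S xi n) ->
  alpha < beta ->
  boundedly_forces (fun xi =>
    ~ ((forall N, exists n, (N <= n)%nat /\ capital S xi n <= alpha) /\
       (forall N, exists n, (N <= n)%nat /\ beta <= capital S xi n))).
Proof.
  intros Ha HL Hab.
  destruct (predictable_strategy (C := C) (fun xi n =>
    if Nat.odd (crossings alpha beta (capital S xi) (Datatypes.S n))
    then bet S xi n else 0)) as [Q HQ].
  { intros n xi xi' Hi Hm.
    rewrite (bet_predictable S n xi xi' Hi Hm).
    rewrite (crossings_ext alpha beta (capital S xi) (capital S xi'));
      [reflexivity|].
    intros i Hin. apply capital_ext. intros j Hj. apply Hi. lia. }
  assert (Hgain : forall xi n,
    (beta - alpha) * INR (Nat.div2 (crossings alpha beta (capital S xi) n))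
      - (Rabs L + Rabs alpha) <= capital Q xi n).
  { intros xi n.
    pose proof (crossing_value_le_gain alpha beta (capital S xi) (capital Q xi)
                  eq_refl) as H.
    assert (HV := H (fun n => ltac:(cbn [capital]; rewrite HQ;
      destruct (Nat.odd _); lra)) n).
    clear H. unfold crossing_value in HV.
    specialize (HL xi n). pose proof (Rle_abs L). pose proof (Rle_abs alpha).
    pose proof (Rabs_pos L). pose proof (Rabs_pos alpha).
    destruct (Nat.odd _); lra. }
  apply (boundedly_forces_rescale _ Q (Rabs a) (Rabs L + Rabs alpha)).
  - intros xi n. rewrite HQ. destruct (Nat.odd _).
    + apply Rle_trans with a; [apply Ha|apply Rle_abs].
    + rewrite Rabs_R0. apply Rabs_pos.
  - intros xi n. specialize (Hgain xi n).
    pose proof (Rmult_le_pos _ _ (Rlt_le _ _ (proj2 (Rlt_0_minus _ _) Hab))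
      (pos_INR (Nat.div2 (crossings alpha beta (capital S xi) n)))).
    lra.
  - intros xi Hxi M. apply NNPP in Hxi. destruct Hxi as [H1 H2].
    destruct (INR_unbounded ((M + (Rabs L + Rabs alpha)) / (beta - alpha)))
      as [k Hk].
    destruct (crossings_unbounded alpha beta (capital S xi) H1 H2 (2 * k))
      as [n Hn].
    exists n. apply Rlt_le_trans with (2 := Hgain xi n).
    assert (Hkd : (k <= Nat.div2 (crossings alpha beta (capital S xi) n))%nat).
    { rewrite Nat.div2_div. apply Nat.div_le_lower_bound; lia. }
    apply le_INR in Hkd.
    apply Rmult_lt_compat_l with (r := beta - alpha) in Hk; [|lra].
    replace ((beta - alpha) * ((M + (Rabs L + Rabs alpha)) / (beta - alpha)))
      with (M + (Rabs L + Rabs alpha)) in Hk by (field; lra).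
    apply Rmult_le_compat_l with (r := beta - alpha) in Hkd; lra.
Qed.

(** * Convergence of a bounded strategy *)

(** The lower end of the [i]-th interval of mesh [1/(k+1)] above [-L]; its
    upper end is [grid L k (S i)]. *)
Definition grid (L : R) (k i : nat) : R := INR i / (INR k + 1) - L.

Lemma grid_step (L : R) (k i : nat) : grid L k (S i) = grid L k i + / (INR k + 1).
Proof.
  unfold grid. rewrite S_INR. pose proof (pos_INR k). field. lra.
Qed.

Lemma grid_interval_between (L l m : R) :
  - L <= l < m -> exists k i, l < grid L k i /\ grid L k (S i) < m.
Proof.
  intros [HL Hlm].
  destruct (INR_unbounded (2 / (m - l))) as [k Hk].
  pose proof (pos_INR k) as Hk0.
  assert (Hstep : 2 * / (INR k + 1) < m - l).
  { apply Rmult_lt_reg_r with (INR k + 1); [lra|].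
    replace (2 * / (INR k + 1) * (INR k + 1)) with (2 / (m - l) * (m - l))
      by (field; lra).
    rewrite (Rmult_comm (m - l)). apply Rmult_lt_compat_r; lra. }
  destruct (nfloor_ex ((l + L) * (INR k + 1))) as [i [Hi1 Hi2]].
  { apply Rmult_le_pos; lra. }
  exists k, (S i). rewrite !grid_step.
  assert (H1 : grid L k i <= l).
  { unfold grid. apply Rmult_le_reg_r with (INR k + 1); [lra|].
    replace ((INR i / (INR k + 1) - L) * (INR k + 1))
      with (INR i - L * (INR k + 1)) by (field; lra). lra. }
  assert (H2 : l < grid L k i + / (INR k + 1)).
  { unfold grid. apply Rmult_lt_reg_r with (INR k + 1); [lra|].
    replace ((INR i / (INR k + 1) - L + / (INR k + 1)) * (INR k + 1))
      with (INR i + 1 - L * (INR k + 1)) by (field; lra). lra. }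
  split; lra.
Qed.

(** If a bounded sequence diverges, then some interval of the grid lies strictly
    between its lower and its upper limit, and is crossed infinitely often. *)
Lemma converges_of_finitely_many_upcrossings (u : nat -> R) (L : R) :
  (forall n, - L <= u n) ->
  ~ unbounded_above u ->
  (forall k i,
    ~ ((forall N, exists n, (N <= n)%nat /\ u n <= grid L k i) /\
       (forall N, exists n, (N <= n)%nat /\ grid L k (S i) <= u n))) ->
  ex_finite_lim_seq u.
Proof.
  intros HL Hub Hcross.
  apply not_all_ex_not in Hub. destruct Hub as [M HM].
  assert (HU : forall n, u n <= M).
  { intros n. apply Rnot_lt_le. intros H. apply HM. now exists n. }
  destruct (ex_LimSup_seq u) as [[s| |] Hs].
  2: { destruct (Hs M 0%nat) as [n [_ Hn]]. specialize (HU n). lra. }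
  2: { destruct (Hs (- L)) as [N HN]. specialize (HN N (le_n N)).
       specialize (HL N). lra. }
  destruct (ex_LimInf_seq u) as [[l| |] Hl].
  2: { destruct (Hl M) as [N HN]. specialize (HN N (le_n N)).
       specialize (HU N). lra. }
  2: { destruct (Hl (- L) 0%nat) as [n [_ Hn]]. specialize (HL n). lra. }
  assert (Hls : l <= s).
  { pose proof (is_LimSup_seq_unique _ _ Hs) as Es.
    pose proof (is_LimInf_seq_unique _ _ Hl) as El.
    pose proof (LimSup_LimInf_seq_le u) as H. rewrite Es, El in H. exact H. }
  destruct (Rle_lt_or_eq_dec _ _ Hls) as [Hlt|Heq].
  - exfalso.
    assert (HLl : - L <= l).
    { apply Rnot_lt_le. intros H.
      assert (He : 0 < - L - l) by lra.
      destruct (proj1 (Hl (mkposreal _ He)) 0%nat) as [n [_ Hn]].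
      simpl in Hn. specialize (HL n). lra. }
    destruct (grid_interval_between L l s (conj HLl Hlt)) as [k [i [H1 H2]]].
    apply (Hcross k i). split; intros N.
    + assert (He : 0 < grid L k i - l) by lra.
      destruct (proj1 (Hl (mkposreal _ He)) N) as [n [Hn Hy]].
      exists n. simpl in Hy. split; [exact Hn|lra].
    + assert (He : 0 < s - grid L k (S i)) by lra.
      destruct (proj1 (Hs (mkposreal _ He)) N) as [n [Hn Hy]].
      exists n. simpl in Hy. split; [exact Hn|lra].
  - subst s. exists l. apply is_LimSup_LimInf_lim_seq; assumption.
Qed.

Lemma forces_convergence {C : R} (S : strategy C) (a L : R) :
  (forall xi n, Rabs (bet S xi n) <= a) ->
  (forall xi n, - L <= capital S xi n) ->
  boundedly_forces (fun xi => ex_finite_lim_seq (capital S xi)).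
Proof.
  intros Ha HL.
  apply boundedly_forces_mono with (fun xi =>
    ~ unbounded_above (capital S xi) /\
    forall k i,
      ~ ((forall N, exists n, (N <= n)%nat /\ capital S xi n <= grid L k i) /\
         (forall N, exists n, (N <= n)%nat /\
            grid L k (Datatypes.S i) <= capital S xi n))).
  - intros xi [Hub Hcross].
    now apply converges_of_finitely_many_upcrossings with L.
  - apply boundedly_forces_and.
    + apply (boundedly_forces_rescale _ S a L Ha HL).
      intros xi H. now apply NNPP.
    + apply boundedly_forces_forall. intros k.
      apply boundedly_forces_forall. intros i.
      apply (forces_finitely_many_upcrossings S a L); [exact Ha|exact HL|].
      rewrite grid_step. pose proof (pos_INR k).
      assert (0 < / (INR k + 1)) by (apply Rinv_0_lt_compat; lra). lra.
Qed.

(** * Stopping *)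

(** The capital of the stopped strategy is defined together with its bets,
    which stop when this capital, and not that of [P], is too low.  Since the
    capital below [-k] stays constant, this stop is for ever; after a bet of
    [P] that is too large the strategy may resume, which is harmless. *)
Definition cautious_bet (k b g : R) : R :=
  if Rle_dec (Rabs b) k then if Rle_dec (- k) g then b else 0 else 0.

Fixpoint stopped_capital {C : R} (P : strategy C) (k : R) (xi : path C)
    (n : nat) : R :=
  match n with
  | O => 0
  | S j =>
      stopped_capital P k xi j
      + cautious_bet k (bet P xi j) (stopped_capital P k xi j)
        * (snd (xi j) - fst (xi j))
  end.

Lemma stopped_capital_ext {C : R} (P : strategy C) (k : R) (n : nat)
    (xi xi' : path C) :
  (forall i, (i < n)%nat -> xi i = xi' i) ->
  stopped_capital P k xi n = stopped_capital P k xi' n.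
Proof.
  induction n as [|n IH]; intros H; simpl; [reflexivity|].
  rewrite IH by (intros; apply H; lia).
  rewrite (bet_predictable P n xi xi').
  - rewrite (H n) by lia. reflexivity.
  - intros i Hi. apply H. lia.
  - rewrite (H n) by lia. reflexivity.
Qed.

Lemma stopped_strategy {C : R} (P : strategy C) (k : R) :
  0 <= k ->
  exists S : strategy C,
    (forall xi n, Rabs (bet S xi n) <= k) /\
    (forall xi n, - (k + k * (2 * C)) <= capital S xi n) /\
    (forall xi,
      (forall n, Rabs (bet P xi n) <= k) ->
      (forall n, - k <= capital P xi n) ->
      forall n, capital S xi n = capital P xi n).
Proof.
  intros Hk.
  destruct (predictable_strategy (C := C)
    (fun xi n => cautious_bet k (bet P xi n) (stopped_capital P k xi n)))
    as [S HS].
  { intros n xi xi' Hi Hm.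
    rewrite (bet_predictable P n xi xi' Hi Hm).
    rewrite (stopped_capital_ext P k n xi xi' Hi). reflexivity. }
  assert (Hcap : forall xi n, capital S xi n = stopped_capital P k xi n).
  { intros xi n. induction n as [|n IH]; simpl; [reflexivity|].
    now rewrite HS, IH. }
  exists S. repeat split.
  - intros xi n. rewrite HS. unfold cautious_bet.
    destruct (Rle_dec _ _); [destruct (Rle_dec _ _)|];
      rewrite ?Rabs_R0; assumption.
  - intros xi n. rewrite Hcap.
    assert (HkC : 0 <= k * (2 * C)).
    { apply Rle_trans with (Rabs (k * (fst (xi 0%nat) - fst (xi 0%nat))));
        [apply Rabs_pos|].
      apply increment_bound. rewrite Rabs_pos_eq; lra. }
    induction n as [|n IH]; simpl; [lra|].
    unfold cautious_bet.
    destruct (Rle_dec _ _) as [Hb|_]; [|lra].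
    destruct (Rle_dec _ _) as [Hg|_]; [|lra].
    pose proof (increment_bound _ _ (snd (xi n)) (fst (xi n)) Hb) as H.
    apply Rabs_le_between in H. lra.
  - intros xi Hb Hc n. rewrite Hcap.
    induction n as [|n IH]; simpl; [reflexivity|].
    rewrite IH. unfold cautious_bet.
    destruct (Rle_dec _ _) as [_|H]; [|destruct (H (Hb n))].
    destruct (Rle_dec _ _) as [_|H]; [reflexivity|destruct (H (Hc n))].
Qed.

Lemma forces_convergence_if_bounded_below {C : R} (P : strategy C) :
  boundedly_forces (fun xi =>
    (exists a, forall n, Rabs (bet P xi n) <= a) ->
    (exists L, forall n, - L <= capital P xi n) ->
    ex_finite_lim_seq (capital P xi)).
Proof.
  apply boundedly_forces_mono with (fun xi => forall k : nat,
    (forall n, Rabs (bet P xi n) <= INR k) ->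
    (forall n, - INR k <= capital P xi n) ->
    ex_finite_lim_seq (capital P xi)).
  - intros xi H [a Ha] [L HL].
    destruct (INR_unbounded (Rmax a L)) as [k Hk].
    pose proof (Rmax_l a L). pose proof (Rmax_r a L).
    apply (H k); intros n; [specialize (Ha n)|specialize (HL n)]; lra.
  - apply boundedly_forces_forall. intros k.
    destruct (stopped_strategy P (INR k) (pos_INR k)) as [S [Hb [Hl Heq]]].
    apply boundedly_forces_mono with
      (fun xi => ex_finite_lim_seq (capital S xi)).
    + intros xi [l Hlim] H1 H2. exists l.
      apply is_lim_seq_ext with (2 := Hlim). now apply Heq.
    + now apply forces_convergence with (INR k) (INR k + INR k * (2 * C)).
Qed.

(** * Applying the result to both signs *)

Lemma LimInf_not_m_infty (u : nat -> R) :
  LimInf_seq u <> m_infty -> exists L, forall n, - L <= u n.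
Proof.
  intros H. apply NNPP. intros Hno. apply H, is_LimInf_seq_unique.
  apply is_LimSup_opp_LimInf_seq. simpl Rbar_opp.
  replace p_infty with (LimSup_seq (fun n => - u n)).
  - unfold LimSup_seq. exact (proj2_sig (ex_LimSup_seq (fun n => - u n))).
  - apply unbounded_above_LimSup. intros M. apply NNPP. intros HM.
    apply Hno. exists M. intros n. apply Rnot_lt_le. intros Hn.
    apply HM. exists n. lra.
Qed.

Lemma LimSup_not_p_infty (u : nat -> R) :
  LimSup_seq u <> p_infty -> exists L, forall n, u n <= L.
Proof.
  intros H. apply NNPP. intros Hno. apply H, unbounded_above_LimSup.
  intros M. apply NNPP. intros HM. apply Hno. exists M. intros n.
  apply Rnot_lt_le. intros Hn. apply HM. now exists n.
Qed.

Lemma bounded_bets_bound {C : R} (P : strategy C) (xi : path C) :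
  bounded_bets P xi -> exists a, forall n, Rabs (bet P xi n) <= a.
Proof.
  unfold bounded_bets. intros H.
  assert (Hub : forall n, Rbar_le (Finite (Rabs (bet P xi n)))
    (Sup_seq (fun n => Finite (Rabs (bet P xi n))))).
  { intros n. apply Sup_seq_minor_le with n. apply Rbar_le_refl. }
  destruct (Sup_seq _) as [a| |].
  - exists a. exact Hub.
  - contradiction.
  - destruct (Hub 0%nat).
Qed.

Theorem proposition2p1 (C : R) (hC : 0 < C) (P : strategy C) :
  can_force (event_imp (bounded_bets P) (converges_or_oscillates P)).
Proof.
  apply boundedly_forces_can_force.
  apply boundedly_forces_mono with (2 := boundedly_forces_and _ _
    (forces_convergence_if_bounded_below P)
    (forces_convergence_if_bounded_below (scale_strategy (-1) P))).
  intros xi [Hpos Hneg]. unfold event_imp.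
  destruct (classic (bounded_bets P xi)) as [HB|HB]; [right|now left].
  apply bounded_bets_bound in HB. unfold converges_or_oscillates.
  destruct (classic (LimInf_seq (capital P xi) = m_infty)) as [Hinf|Hinf].
  - destruct (classic (LimSup_seq (capital P xi) = p_infty)) as [Hsup|Hsup];
      [right; now split|left].
    destruct Hneg as [l Hl].
    + destruct HB as [a Ha]. exists a. intros n.
      change (Rabs (-1 * bet P xi n) <= a).
      replace (-1 * bet P xi n) with (- bet P xi n) by ring.
      rewrite Rabs_Ropp. apply Ha.
    + destruct (LimSup_not_p_infty _ Hsup) as [L HL]. exists L. intros n.
      rewrite capital_scale. specialize (HL n). lra.
    + exists (-1 * l).
      apply is_lim_seq_ext with
        (fun n => -1 * capital (scale_strategy (-1) P) xi n).
      * intros n. rewrite capital_scale. ring.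
      * apply (is_lim_seq_scal_l _ (-1) (Finite l)), Hl.
  - left. exact (Hpos HB (LimInf_not_m_infty _ Hinf)).
Qed.
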